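(* Let $a,b$ be non-zero real numbers and let $(j_n)_{n\ge 0}$ be the bi-periodic Jacobsthal sequence associated with $a,b$. Then for every positive integer $n$, $$2\left(\frac{b}{a}\right)^{2\varepsilon(n)} j_{n-1}j_{n+1}-2\frac{b}{a}\,j_n^2=2^n\left(-\frac{b}{a}\right)^{\varepsilon(n)},$$ which can be simplified as $$\left(\frac{b}{a}\right)^{\varepsilon(n)} j_{n-1}j_{n+1}-\left(\frac{b}{a}\right)^{1-\varepsilon(n)} j_n^2=(-1)^{\varepsilon(n)}2^{n-1}.$$
   Context: Fix non-zero real numbers $a,b$. The parity function is $\varepsilon(n)=0$ if $n$ is even and $\varepsilon(n)=1$ if $n$ is odd. The bi-periodic Jacobsthal sequence is defined by $j_0=0$, $j_1=1$, and for $n\ge 2$: $j_n=aj_{n-1}+2j_{n-2}$ if $n$ is even, $j_n=bj_{n-1}+2j_{n-2}$ if $n$ is odd. *)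

(* Defs.v *)
From mathcomp Require Import all_boot all_order all_algebra.
From mathcomp Require Import reals.
Set Implicit Arguments.
Unset Strict Implicit.
Unset Printing Implicit Defensive.
Import Order.TTheory GRing.Theory Num.Theory.
Local Open Scope ring_scope.

Definition parity (n : nat) : nat := if odd n then 1%N else 0%N.

Fixpoint biperiodic_jacobsthal (R : realType) (a b : R) (n : nat) : R :=
  match n with
  | 0 => 0
  | 1 => 1
  | (m.+1 as k).+1 =>
      (if odd n then b else a) * biperiodic_jacobsthal a b k
      + 2 * biperiodic_jacobsthal a b m
  end.

(* Main.v *)
(** Clearing the denominator [a], both identities reduce to the value of
    [D n = c' * j n * j n.+2 - c * j n.+1 ^+ 2], where [(c', c)] is [(a, b)] or
    [(b, a)] according to parity. Expanding [j n.+3] and one factor of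
    [j n.+2 ^+ 2] by the recurrence cancels the [a * b] terms and gives
    [D n.+1 = -2 * D n]. *)
Require Import Defs.
From mathcomp Require Import all_boot all_order all_algebra.
From mathcomp Require Import reals.
From mathcomp Require Import ring.
Set Implicit Arguments.
Unset Strict Implicit.
Unset Printing Implicit Defensive.
Import Order.TTheory GRing.Theory Num.Theory.
Local Open Scope ring_scope.

Lemma biperiodic_jacobsthalSS (R : realType) (a b : R) (n : nat) :
  biperiodic_jacobsthal a b n.+2 =
    (if odd n then b else a) * biperiodic_jacobsthal a b n.+1
    + 2 * biperiodic_jacobsthal a b n.
Proof. by rewrite /= negbK. Qed.

(** The factor [a] on the right is inherited from the initial value [D 0 = - a]. *)
Lemma biperiodic_jacobsthal_cassini (R : realType) (a b : R) (n : nat) :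
  let j := biperiodic_jacobsthal a b in
  (if odd n then a else b) * j n * j n.+2
    - (if odd n then b else a) * j n.+1 ^+ 2
    = a * (-1) ^+ n.+1 * 2 ^+ n.
Proof.
move=> j; elim: n => [|n IHn]; first by rewrite /j /=; ring.
have -> : a * (-1) ^+ n.+2 * 2 ^+ n.+1 = - 2 * (a * (-1) ^+ n.+1 * 2 ^+ n).
  by rewrite [(-1) ^+ n.+2]exprS [2 ^+ n.+1]exprS; ring.
rewrite -IHn /j (biperiodic_jacobsthalSS a b n.+1) biperiodic_jacobsthalSS.
by rewrite oddS; case: (odd n) => /=; ring.
Qed.

Theorem theorem6 (R : realType) (a b : R) (ha : a != 0) (hb : b != 0)
    (n : nat) (hn : (0 < n)%N) :
  let j := biperiodic_jacobsthal a b in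
  2 * (b / a) ^+ (2 * parity n) * j n.-1 * j n.+1 - 2 * (b / a) * j n ^+ 2
    = 2 ^+ n * (- (b / a)) ^+ parity n
  /\
  (b / a) ^+ parity n * j n.-1 * j n.+1
    - (b / a) ^+ (1 - parity n) * j n ^+ 2
    = (-1) ^+ parity n * 2 ^+ n.-1.
Proof.
case: n hn => // n _ j.
have simplified : (b / a) ^+ parity n.+1 * j n * j n.+2
    - (b / a) ^+ (1 - parity n.+1) * j n.+1 ^+ 2
    = (-1) ^+ parity n.+1 * 2 ^+ n.
  (* Multiplying by [a] turns the coefficients [1] and [b / a] into [a] and [b]; the sign depends
     only on the parity of [n.+1]. *)
  apply: (mulfI ha); have := biperiodic_jacobsthal_cassini a b n.
  rewrite -/j -[(-1) ^+ n.+1]signr_odd -[a * _ * _]mulrA /parity oddS.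
  by case: (odd n) => /= <-; field.
(* The first identity is the simplified one multiplied by [2 * (b / a) ^+ parity n.+1]. *)
split=> //; rewrite [2 ^+ n.+1]exprS -pred_Sn; move: simplified.
rewrite /parity oddS; case: (odd n) => /= simplified.
  (* Exposes the right side of [simplified], so that it can be replaced by the left. *)
  have -> : 2 ^+ n = (-1) ^+ 0 * 2 ^+ n :> R by ring.
  by rewrite -simplified; ring.
have -> : 2 ^+ n = - ((-1) ^+ 1 * 2 ^+ n) :> R by ring.
by rewrite -simplified; ring.
Qed.
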